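(* Let $(A,\ast)$ and $(B,\bullet)$ be Jacobi-Jordan algebras and let $\rho_1:A\to gl(B)$, $\rho_2:B\to gl(A)$ be linear maps. Then $(A,B,\rho_1,\rho_2)$ is a matched pair of Jacobi-Jordan algebras if and only if $(A\oplus B,\triangleleft)$ is a Jacobi-Jordan algebra, where for all $x,y\in A$, $a,b\in B$, $$(x+a)\triangleleft(y+b):=(x\ast y+\rho_2(a)y+\rho_2(b)x)+(a\bullet b+\rho_1(x)b+\rho_1(y)a).$$
   Context: All vector spaces are finite dimensional over a field $\mathbb{K}$ of characteristic $0$; an algebra is a vector space with a bilinear product, not assumed associative, and $gl(V)$ is the space of linear endomorphisms of $V$. A Jacobi-Jordan algebra is an algebra $(A,\ast)$ with $x\ast y=y\ast x$ and $(x\ast y)\ast z+(y\ast z)\ast x+(z\ast x)\ast y=0$ for all $x,y,z\in A$. A representation of a Jacobi-Jordan algebra $(A,\ast)$ is a pair $(V,\rho)$ with $V$ a vector space and $\rho:A\to gl(V)$ linear such that $\rho(x\ast y)=-\rho(x)\rho(y)-\rho(y)\rho(x)$ for all $x,y\in A$. A matched pair of Jacobi-Jordan algebras $(A,B,\rho_1,\rho_2)$ consists of two Jacobi-Jordan algebras $(A,\ast)$, $(B,\bullet)$ together with representations $\rho_1:A\to gl(B)$ of $A$ on $B$ and $\rho_2:B\to gl(A)$ of $B$ on $A$ such that for all $x,y\in A$, $a,b\in B$: $$\rho_1(x)(a\bullet b)+(\rho_1(x)a)\bullet b+(\rho_1(x)b)\bullet a+\rho_1(\rho_2(a)x)b+\rho_1(\rho_2(b)x)a=0,$$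 $$\rho_2(a)(x\ast y)+(\rho_2(a)x)\ast y+(\rho_2(a)y)\ast x+\rho_2(\rho_1(x)a)y+\rho_2(\rho_1(y)a)x=0.$$ *)

(* Defs.v *)
From HB Require Import structures.
From mathcomp Require Import all_boot all_order all_algebra.

Set Implicit Arguments.
Unset Strict Implicit.
Unset Printing Implicit Defensive.

Import GRing.Theory.
Local Open Scope ring_scope.

(* A product is a bare binary function: its bilinearity is part of the
   predicate, hence part of what is claimed for the product on A (+) B. *)
Record jacobi_jordan (K : fieldType) (A : vectType K) (mul : A -> A -> A) :
    Prop := JacobiJordan {
  jj_linearl : forall y, linear (mul^~ y);
  jj_linearr : forall x, linear (mul x);
  jj_comm : forall x y, mul x y = mul y x;
  jj_jacobi : forall x y z,
    mul (mul x y) z + mul (mul y z) x + mul (mul z x) y = 0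
}.

Definition jj_representation (K : fieldType) (A V : vectType K)
    (mul : A -> A -> A) (rho : {linear A -> 'End(V)}) : Prop :=
  forall x y : A,
    rho (mul x y) = - (rho x \o rho y)%VF - (rho y \o rho x)%VF.

Record jj_matched_pair (K : fieldType) (A B : vectType K)
    (mulA : A -> A -> A) (mulB : B -> B -> B)
    (rho1 : {linear A -> 'End(B)}) (rho2 : {linear B -> 'End(A)}) :
    Prop := JJMatchedPair {
  mp_jjA : jacobi_jordan mulA;
  mp_jjB : jacobi_jordan mulB;
  mp_rep1 : jj_representation mulA rho1;
  mp_rep2 : jj_representation mulB rho2;
  mp_compat1 : forall (x : A) (a b : B),
    rho1 x (mulB a b) + mulB (rho1 x a) b + mulB (rho1 x b) a
      + rho1 (rho2 a x) b + rho1 (rho2 b x) a = 0;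
  mp_compat2 : forall (a : B) (x y : A),
    rho2 a (mulA x y) + mulA (rho2 a x) y + mulA (rho2 a y) x
      + rho2 (rho1 x a) y + rho2 (rho1 y a) x = 0
}.

(* A (+) B is the product space A * B, the element x + a being (x, a). *)
Definition bicrossed_mul (K : fieldType) (A B : vectType K)
    (mulA : A -> A -> A) (mulB : B -> B -> B)
    (rho1 : {linear A -> 'End(B)}) (rho2 : {linear B -> 'End(A)})
    (u v : (A * B)%type) : (A * B)%type :=
  let: (x, a) := u in let: (y, b) := v in
  (mulA x y + rho2 a y + rho2 b x, mulB a b + rho1 x b + rho1 y a).

(* Main.v *)
(* The A-component of the Jacobi sum of x + a, y + b, z + c in A (+) B is the
   Jacobi sum of x, y, z plus three cyclic copies of the defect of rho2 from
   being a representation and three of its defect from the second compatibility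
   condition.  On arguments a, b, z only one representation defect
   survives, on x, y, c only one compatibility defect, so the A-component
   vanishes identically iff both defects do.  The B-component is the A-component
   of B (+) A. *)
Require Import Defs.
From HB Require Import structures.
From mathcomp Require Import all_boot all_order all_algebra.

Import GRing.Theory.
Local Open Scope ring_scope.

Set Implicit Arguments.
Unset Strict Implicit.

Definition jacobiator (V : zmodType) (mul : V -> V -> V) (u v w : V) : V :=
  mul (mul u v) w + mul (mul v w) u + mul (mul w u) v.

(** Evaluated at a vector, so that its three terms occur literally in the expanded Jacobi sum of A
    (+) B. *)
Definition rep_defect (K : fieldType) (A V : vectType K) (mul : A -> A -> A)
    (rho : {linear A -> 'End(V)}) (x y : A) (v : V) : V :=
  rho (mul x y) v + rho x (rho y v) + rho y (rho x v).

Definition compat_defect (K : fieldType) (A B : vectType K)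
    (mulA : A -> A -> A) (rho1 : {linear A -> 'End(B)})
    (rho2 : {linear B -> 'End(A)}) (a : B) (x y : A) : A :=
  rho2 a (mulA x y) + mulA (rho2 a x) y + mulA (rho2 a y) x
    + rho2 (rho1 x a) y + rho2 (rho1 y a) x.

Lemma jj_representationP (K : fieldType) (A V : vectType K)
    (mul : A -> A -> A) (rho : {linear A -> 'End(V)}) :
  jj_representation mul rho <-> forall x y v, rep_defect mul rho x y v = 0.
Proof.
split=> [rep x y v | rep x y].
  by rewrite /rep_defect rep !lfunE /= !lfunE /= !comp_lfunE addrAC subrK addNr.
apply/lfunP=> v; rewrite !lfunE /= !lfunE /= !comp_lfunE -opprD.
by apply/eqP; rewrite -addr_eq0 addrA; apply/eqP/rep.
Qed.

Section JacobiJordan.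

Variables (K : fieldType) (A : vectType K) (mul : A -> A -> A).
Hypothesis jj : jacobi_jordan mul.

Lemma jj_mulDl x y z : mul (x + y) z = mul x z + mul y z.
Proof. by have := jj_linearl jj z 1 x y; rewrite !scale1r. Qed.

Lemma jj_mul0l x : mul 0 x = 0.
Proof. by apply: (addrI (mul 0 x)); rewrite -jj_mulDl !addr0. Qed.

Lemma jj_mul0r x : mul x 0 = 0.
Proof. by rewrite (jj_comm jj) jj_mul0l. Qed.

End JacobiJordan.

Section BicrossedProduct.

Variables (K : fieldType) (A B : vectType K).
Variables (mulA : A -> A -> A) (mulB : B -> B -> B).
Variables (rho1 : {linear A -> 'End(B)}) (rho2 : {linear B -> 'End(A)}).
Local Notation mulAB := (bicrossed_mul mulA mulB rho1 rho2).
Local Notation mulBA := (bicrossed_mul mulB mulA rho2 rho1).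

(** The formula for the product is invariant under exchanging (A, [rho1]) with (B, [rho2]), so both
    sides compute to the same term. Hence only A-components need study. *)
Lemma jacobiator_bicrossed_swap x a y b z c :
  (jacobiator mulAB (x, a) (y, b) (z, c)).2
  = (jacobiator mulBA (a, x) (b, y) (c, z)).1.
Proof. by []. Qed.

Hypotheses (jjA : jacobi_jordan mulA) (jjB : jacobi_jordan mulB).

Lemma bicrossed_mul_linearl1 k u v w :
  (mulAB (k *: u + v) w).1 = k *: (mulAB u w).1 + (mulAB v w).1.
Proof.
case: u v w => [x a] [y b] [z c] /=.
rewrite [mulA (_ + _) z](jj_linearl jjA z k x y).
rewrite !linearP /= add_lfunE scale_lfunE !scalerDr.
by rewrite [RHS]addrACA (addrACA _ _ (mulA y z)).
Qed.

Lemma bicrossed_mulC1 u v : (mulAB u v).1 = (mulAB v u).1.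
Proof. by case: u v => [x a] [y b] /=; rewrite (jj_comm jjA) addrAC. Qed.

Lemma jacobiator_bicrossed1 x a y b z c :
  (jacobiator mulAB (x, a) (y, b) (z, c)).1
  = jacobiator mulA x y z
    + (rep_defect mulB rho2 a b z + rep_defect mulB rho2 b c x
       + rep_defect mulB rho2 c a y)
    + (compat_defect mulA rho1 rho2 c x y + compat_defect mulA rho1 rho2 a y z
       + compat_defect mulA rho1 rho2 b z x).
Proof.
rewrite /jacobiator /rep_defect /compat_defect /= !(jj_mulDl jjA) !linearD /=.
rewrite !add_lfunE.
(* Each cyclic summand has expanded into nine terms. Terms 1, 10, 19 form the Jacobi sum of x, y, z;
   the triples are the representation defects and the quintuples the compatibility defects. *)
by rewrite [LHS](AC ((3*3*3)*(3*3*3)*(3*3*3))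
  ((1*10*19) * ((4*17*27)*(13*26*9)*(22*8*18))
   * ((7*20*12*24*14)*(16*2*21*6*23)*(25*11*3*15*5)))).
Qed.

Lemma jacobiator_bicrossed1_eq0 :
  (forall u v w, (jacobiator mulAB u v w).1 = 0) <->
  jj_representation mulB rho2
  /\ forall a x y, compat_defect mulA rho1 rho2 a x y = 0.
Proof.
have simp0 := (jj_mul0l jjA, jj_mul0r jjA, jj_mul0l jjB, jj_mul0r jjB,
               linear0, zero_lfunE, addr0, add0r).
split=> [jac | [/jj_representationP rep comp]].
  split=> [|a x y].
    apply/jj_representationP => a b z.
    (* By multilinearity, every defect with a zero argument vanishes. *)
    have := jac (0, a) (0, b) (z, 0); rewrite jacobiator_bicrossed1.
    by rewrite /jacobiator /rep_defect /compat_defect !simp0.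
  have := jac (x, 0) (y, 0) (0, a); rewrite jacobiator_bicrossed1.
  by rewrite /jacobiator /rep_defect /compat_defect !simp0.
move=> [x a] [y b] [z c]; rewrite jacobiator_bicrossed1 !rep !comp !addr0.
exact: jj_jacobi jjA x y z.
Qed.

End BicrossedProduct.

Unset Implicit Arguments.
Set Strict Implicit.

Theorem theorem2p11 (K : fieldType) (charK0 : [pchar K] =i pred0)
    (A B : vectType K) (mulA : A -> A -> A) (mulB : B -> B -> B)
    (jjA : jacobi_jordan mulA) (jjB : jacobi_jordan mulB)
    (rho1 : {linear A -> 'End(B)}) (rho2 : {linear B -> 'End(A)}) :
  jj_matched_pair mulA mulB rho1 rho2 <->
  jacobi_jordan (bicrossed_mul mulA mulB rho1 rho2).
Proof.
have jac1P := jacobiator_bicrossed1_eq0 rho1 rho2 jjA jjB.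
have jac2P := jacobiator_bicrossed1_eq0 rho2 rho1 jjB jjA.
split=> [[_ _ rep1 rep2 comp1 comp2] | [_ _ _ jac]].
  have mulC u v : bicrossed_mul mulA mulB rho1 rho2 u v
                  = bicrossed_mul mulA mulB rho1 rho2 v u.
    case: u v => [x a] [y b]; congr pair.
      exact: bicrossed_mulC1 jjA (x, a) (y, b).
    (* The B-component is, by computation, the A-component of the swapped product. *)
    exact: bicrossed_mulC1 jjB (a, x) (b, y).
  have linl w : linear ((bicrossed_mul mulA mulB rho1 rho2)^~ w).
    move=> k [x a] [y b]; case: w => [z c]; congr pair.
      exact: (bicrossed_mul_linearl1 mulB rho1 rho2 jjA k (x, a) (y, b) (z, c)).
    exact: (bicrossed_mul_linearl1 mulA rho2 rho1 jjB k (a, x) (b, y) (c, z)).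
  split=> // [w k u v | [x a] [y b] [z c]].
    (* Right linearity follows from left linearity by commutativity. *)
    by rewrite mulC (linl w k u v) !(mulC _ w).
  apply: (@pair_equal_spec _ _ _ _ _ _).2; split.
    by apply: jac1P.2 (x, a) (y, b) (z, c).
  by apply: jac2P.2 (a, x) (b, y) (c, z).
have [|rep2 comp2] := jac1P.1; first by move=> u v w; rewrite /jacobiator jac.
have [|rep1 comp1] := jac2P.1.
  move=> [a x] [b y] [c z].
  by rewrite -jacobiator_bicrossed_swap /jacobiator jac.
(* [comp1] and [comp2] unfold to the two compatibility conditions, the first being the second with A
   and B exchanged. *)
by split.
Qed.
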